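(* Let $\alpha,\beta\in\mathbb{N}^{\ast}$ and $x\in\mathbb{Z}_p$. For every $n\in\mathbb{N}^{\ast}$, \[ g_{n,q}^{(\alpha,\beta)}(x)=q^{-\alpha x}\sum_{k=0}^{n}\binom{n}{k}q^{\alpha kx}\,g_{k,q}^{(\alpha,\beta)}\,[x]_{q^{\alpha}}^{\,n-k}. \] Moreover, \[ g_{n,q}^{(\alpha,\beta)}(x)=q^{-\alpha x}\left(q^{\alpha x}g_{q}^{(\alpha,\beta)}+[x]_{q^{\alpha}}\right)^{n}, \] where the right-hand side is to be read with the umbral (symbolic) convention: expand by the binomial theorem and replace $\left(g_{q}^{(\alpha,\beta)}\right)^{k}$ by $g_{k,q}^{(\alpha,\beta)}$.
   Context: Let $p$ be a fixed odd prime, $\mathbb{Z}_p$ the ring of $p$-adic integers, $\mathbb{C}_p$ the completion of an algebraic closure of $\mathbb{Q}_p$, and $q\in\mathbb{C}_p$ with $|q-1|_p<1$. Write $\mathbb{N}=\{1,2,\dots\}$ and $\mathbb{N}^{\ast}=\mathbb{N}\cup\{0\}$. For $x$, the $q$-number is $[x]_q=\frac{1-q^x}{1-q}$. For a uniformly differentiable function $f$ on $\mathbb{Z}_p$, the fermionic $p$-adic $q$-integral is \[ \int_{\mathbb{Z}_p}f(\xi)\,d\mu_{-q}(\xi)=\lim_{N\to\infty}\frac{1}{[p^N]_{-q}}\sum_{\xi=0}^{p^N-1}q^{\xi}f(\xi)(-1)^{\xi}, \] and $d\mu_{-q^{\beta}}$ denotes the same with $q$ replaced by $q^{\beta}$.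 The modified $q$-Genocchi polynomials with weight $\alpha$ and $\beta$ are defined for $n\in\mathbb{N}^{\ast}$ by \[ \frac{g_{n+1,q}^{(\alpha,\beta)}(x)}{n+1}=\int_{\mathbb{Z}_p}q^{-\beta\xi}[x+\xi]_{q^{\alpha}}^{n}\,d\mu_{-q^{\beta}}(\xi), \] with $g_{0,q}^{(\alpha,\beta)}=0$; the $q$-Genocchi numbers with weight $\alpha$ and $\beta$ are $g_{n,q}^{(\alpha,\beta)}=g_{n,q}^{(\alpha,\beta)}(0)$. *)

(* Defs.v *)
From HB Require Import structures.
From mathcomp Require Import all_boot all_order all_algebra.
From mathcomp Require Import all_classical all_reals all_analysis.

Set Implicit Arguments.
Unset Strict Implicit.
Unset Printing Implicit Defensive.

Import Order.TTheory GRing.Theory Num.Theory.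
Import numFieldNormedType.Exports.

Local Open Scope classical_set_scope.
Local Open Scope ring_scope.

(* Nonarchimedean absolute values.  They cannot be given by the norm of a
   [normedZmodType], which satisfies |x *+ n| = |x| *+ n. *)
Record absvalue (R : realType) (F : fieldType) := AbsValue {
  absv :> F -> R ;
  absv_ge0 : forall x, 0 <= absv x ;
  absv_eq0 : forall x, absv x = 0 <-> x = 0 ;
  absvM : forall x y, absv (x * y) = absv x * absv y ;
  absvD_max : forall x y, absv (x + y) <= Num.max (absv x) (absv y) }.

(* The field F with the metric v (x - y). *)
Definition valued (R : realType) (F : fieldType) (v : absvalue R F) : Type := F.

Section ValuedMetric.
Context {R : realType} {F : fieldType} (v : absvalue R F).

HB.instance Definition _ := GRing.Field.copy (valued v) F.
HB.instance Definition _ := isPointed.Build (valued v) 0.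

Let dist (x y : valued v) : R := v (x - y).

Let distxx x : dist x x = 0.
Proof. by apply/absv_eq0; rewrite subrr. Qed.

Let dist_positivity x y : dist x y = 0 -> x = y.
Proof. by move/absv_eq0/eqP; rewrite subr_eq0 => /eqP. Qed.

Let absvN1 : v (- 1) = 1.
Proof.
have v1 : v 1 = 1.
  have v1_neq0 : v 1 != 0 by apply/eqP => /absv_eq0/eqP; rewrite oner_eq0.
  by apply: (mulfI v1_neq0); rewrite -absvM !mulr1.
by apply/eqP; rewrite -(@eqrXn2 _ 2%N) ?absv_ge0 // expr2 -absvM mulrNN mulr1
  v1 expr1n.
Qed.

Let dist_sym x y : dist x y = dist y x.
Proof. by rewrite /dist -opprB -mulN1r absvM absvN1 mul1r. Qed.

Let dist_triangle y x z : dist x z <= dist x y + dist y z.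
Proof.
rewrite /dist -(subrKA y x (- z)); apply: le_trans (absvD_max _ _ _) _.
by rewrite ge_max lerDl lerDr !absv_ge0.
Qed.

HB.instance Definition _ :=
  isMetric.Build R (valued v) distxx dist_positivity dist_sym dist_triangle.

End ValuedMetric.

Section Padic.
Context {R : realType} (p : nat) {F : fieldType} (v : absvalue R F).
Local Notation K := (valued v).

(* Q_p, realised inside K as the closure of Q: when K is complete and satisfies
   [extends_padic_absv], this is the completion of Q for the p-adic absolute
   value. *)
Definition padic_rat : set K := closure (range (@ratr K)).

Definition padic_int : set K := [set x | padic_rat x /\ v x <= 1].

(* By multiplicativity this fixes the absolute value on all of Q. *)
Definition extends_padic_absv : Prop :=
  forall m : nat, (0 < m)%N -> v m%:R = p%:R ^- logn p m.

(* The elements of K that are algebraic over Q_p. *)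
Definition padic_alg : set K :=
  [set z | exists2 P : {poly K}, P != 0 &
             (forall i, padic_rat P`_i) /\ root P z].

(* K is the completion of an algebraic closure of Q_p: it is complete, the
   elements algebraic over Q_p form an algebraically closed field, and they are
   dense in K. *)
Record is_Cp : Prop := IsCp {
  Cp_complete : forall F : set_system K, ProperFilter F -> cauchy F -> cvg F ;
  Cp_absv : extends_padic_absv ;
  Cp_closed : forall P : {poly K}, (forall i, padic_alg P`_i) ->
    (1 < size P)%N -> exists2 z : K, padic_alg z & root P z ;
  Cp_dense : closure padic_alg = setT }.

End Padic.

Section QCalculus.
Context {R : realType} {F : fieldType} {v : absvalue R F}.
Local Notation K := (valued v).

(* The filter "n --> x" on the natural numbers, for the topology of K. *)
Definition nat_nbhs (x : K) : set_system nat :=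
  filter_from (nbhs x) (fun A => [set n : nat | A n%:R]).

(* q^x for x in Z_p and |q - 1| < 1: the continuous extension to Z_p of
   n |-> q^n. *)
Definition qpow (q x : K) : K := lim ((fun n : nat => q ^+ n) @ nat_nbhs x).

(* [x]_q for x in Z_p, with the usual convention [x]_1 = lim_(q -> 1) [x]_q = x. *)
Definition qnum (q x : K) : K :=
  if q == 1 then x else (1 - qpow q x) / (1 - q).

(* [n]_q for natural n and arbitrary q != 1; separate from [qnum] because it is
   used at -q, which is not in the disc |z - 1| < 1. *)
Definition qnat (q : K) (n : nat) : K := (1 - q ^+ n) / (1 - q).

Definition fermionic_sum (p : nat) (q : K) (f : K -> K) (N : nat) : K :=
  (qnat (- q) (p ^ N))^-1 *
    \sum_(0 <= xi < p ^ N) q ^+ xi * f xi%:R * (-1) ^+ xi.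

(* The integral of f over Z_p against mu_{-q}. *)
Definition fermionic_integral (p : nat) (q : K) (f : K -> K) : K :=
  limn (fermionic_sum p q f).

Definition genocchi_poly (p : nat) (q : K) (alpha beta n : nat) (x : K) : K :=
  if n is m.+1 then
    m.+1%:R * fermionic_integral p (q ^+ beta)
      (fun xi => qpow q (- (beta%:R * xi)) * qnum (q ^+ alpha) (x + xi) ^+ m)
  else 0.

Definition genocchi_num (p : nat) (q : K) (alpha beta n : nat) : K :=
  genocchi_poly p q alpha beta n 0.

(* Umbral evaluation: the linear map {poly K} -> K with 'X^k |-> a k. *)
Definition umbral (a : nat -> K) (P : {poly K}) : K :=
  \sum_(k < size P) P`_k * a k.

End QCalculus.

(* Main.v *)
Require Import Defs.
From HB Require Import structures.
From mathcomp Require Import all_boot all_order all_algebra.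
From mathcomp Require Import all_classical all_reals all_analysis.
From mathcomp Require Import ring lra.
Import Order.TTheory GRing.Theory Num.Theory.
Import numFieldNormedType.Exports.
Local Open Scope classical_set_scope.
Local Open Scope ring_scope.

(* Since [x + xi]_t = [x]_t + t^x [xi]_t for t = q^alpha, the binomial theorem
   under the integral sign expresses the moments of [x + xi]_t through those of
   [xi]_t, and n 'C(n-1, k) = (k+1) 'C(n, k+1) turns this into the identity for
   the Genocchi polynomials; the shift of k produces the factor q^(- alpha x).
   Linearity of the integral requires the defining limits to exist.  The weight
   q^(- beta xi) cancels the density of mu_{-q^beta}, so one needs the limit of
   T_k(M) = \sum_(xi < M) (-1)^xi [xi]_t^k along M = p^N.  For odd M,
     (1 + t^k) T_k(M) + \sum_(j < k) 'C(k, j) t^j T_j(M) = 0^k + [M]_t^k,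
   where 1 + t^k is nonzero because p is odd, and [p^N]_t tends to 0; the limit
   therefore exists by strong induction on k, whether or not t = 1. *)

(** * Elementary consequences of the ultrametric inequality *)

Section Ultrametric.
Context {R : realType} {F : fieldType} (v : absvalue R F).

Lemma absv0 : v 0 = 0.
Proof. exact/absv_eq0. Qed.

Lemma absv1 : v 1 = 1.
Proof.
have v1_neq0 : v 1 != 0 by apply/eqP => /absv_eq0/eqP; rewrite oner_eq0.
by apply: (mulfI v1_neq0); rewrite -absvM !mulr1.
Qed.

Lemma absvN x : v (- x) = v x.
Proof.
suff vN1 : v (- 1) = 1 by rewrite -mulN1r absvM vN1 mul1r.
apply/eqP; rewrite -(@eqrXn2 _ 2%N) ?absv_ge0 // expr2 -absvM mulrNN mulr1.
by rewrite absv1 expr1n.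
Qed.

Lemma absvBC x y : v (x - y) = v (y - x).
Proof. by rewrite -opprB absvN. Qed.

Lemma absvX x n : v (x ^+ n) = v x ^+ n.
Proof. by elim: n => [|n IHn]; rewrite ?absv1 // !exprS absvM IHn. Qed.

Lemma absv_gt0 x : x != 0 -> 0 < v x.
Proof.
by move=> x0; rewrite lt_def absv_ge0 andbT; apply/eqP => /absv_eq0/eqP;
  exact/negP.
Qed.

Lemma absvV x : v x^-1 = (v x)^-1.
Proof.
have [->|x0] := eqVneq x 0; first by rewrite invr0 absv0 invr0.
have vx0 : v x != 0 by rewrite gt_eqF ?absv_gt0.
by apply: (mulfI vx0); rewrite -absvM !divff // absv1.
Qed.

Lemma absvD_le x y c : v x <= c -> v y <= c -> v (x + y) <= c.
Proof.
by move=> xc yc; apply: le_trans (absvD_max _ _ _) _; rewrite ge_max xc.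
Qed.

Lemma absvD_lt x y c : v x < c -> v y < c -> v (x + y) < c.
Proof.
by move=> xc yc; apply: le_lt_trans (absvD_max _ _ _) _; rewrite gt_max xc.
Qed.

Lemma absvB_lt x y c : v x < c -> v y < c -> v (x - y) < c.
Proof. by move=> xc yc; apply: absvD_lt => //; rewrite absvN. Qed.

Lemma absv_sum_le (I : Type) (r : seq I) (P : pred I) (f : I -> F) c :
  0 <= c -> (forall i, P i -> v (f i) <= c) -> v (\sum_(i <- r | P i) f i) <= c.
Proof.
move=> c0 fc; elim/big_ind: _ => [|x y|i /fc//]; first by rewrite absv0.
exact: absvD_le.
Qed.

Lemma absv_nat_le1 n : v n%:R <= 1.
Proof.
by elim: n => [|n IHn]; rewrite ?absv0 // -addn1 natrD absvD_le ?absv1.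
Qed.

Lemma absv_int (z : int) : v z%:~R = v `|z|%N%:R.
Proof. by case: z => n //; rewrite NegzE rmorphN absvN abszN. Qed.

Lemma absv_int_le1 (z : int) : v z%:~R <= 1.
Proof. by rewrite absv_int absv_nat_le1. Qed.

(** If [v u < 1], then 1, being the difference of [u] and [u - 1], would have absolute value below
    1. *)
Lemma absv_near1 u : v (u - 1) < 1 -> v u = 1.
Proof.
move=> u1; have u_le1 : v u <= 1.
  by rewrite -(subrK 1 u) absvD_le ?absv1 // ltW.
apply/eqP; rewrite eq_le u_le1 leNgt; apply/negP => u_lt1.
by have := absvB_lt _ _ _ u_lt1 u1; rewrite opprB addrC subrK absv1 ltxx.
Qed.

(** The cofactor of [u ^+ m - 1] is a geometric sum of elements of absolute value 1, hence has
    absolute value at most 1. *)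
Lemma absv_exprB_le u m n : v u = 1 ->
  v (u ^+ (m * n) - 1) <= v (u ^+ m - 1).
Proof.
move=> u1; rewrite exprM subrX1 absvM ler_piMr ?absv_ge0 //.
by apply: absv_sum_le => // i _; rewrite !absvX u1 !expr1n.
Qed.

Lemma absv_exp_near1 u n : v (u - 1) < 1 -> v (u ^+ n - 1) < 1.
Proof.
move=> u1; apply: le_lt_trans (u1).
by rewrite -[n]mul1n -{2}[u]expr1 absv_exprB_le // absv_near1.
Qed.

End Ultrametric.

Lemma near_expr_lt (R : realType) (r e : R) : 0 <= r < 1 -> 0 < e ->
  \forall N \near \oo, r ^+ N < e.
Proof.
move=> /andP[r0 r1] e0.
have /cvgrPdist_lt/(_ _ e0) : GRing.exp r n @[n --> \oo] --> (0 : R).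
  by apply: cvg_expr; rewrite ger0_norm.
by apply: filterS => N; rewrite sub0r normrN ger0_norm // exprn_ge0.
Qed.

(** * Limits for the metric of an absolute value *)

Section Limits.
Context {R : realType} {F : fieldType} {v : absvalue R F}.
Local Notation K := (valued v).

Lemma cvg_absvP {T : Type} {G : set_system T} {FG : Filter G} (f : T -> K)
    (l : K) :
  f @ G --> l <-> forall e, 0 < e -> \forall t \near G, v (f t - l) < e.
Proof.
have ballE y e z : @ball R K y e z = (v (z - y) < e).
  by rewrite ballEmdist absvBC.
split => [/cvg_ballP fl e e0|fl]; first by near do rewrite -ballE; exact: fl.
by apply/cvg_ballP => e e0; near do rewrite ballE; exact: fl.
Unshelve. all: by end_near. Qed.

Lemma nbhs_absv (x : K) (e : R) : 0 < e -> nbhs x [set y : K | v (y - x) < e].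
Proof. by move=> e0; have /cvg_absvP/(_ e e0) := @cvg_id K (nbhs x). Qed.

Section Arithmetic.
Context {T : Type} {G : set_system T} {FG : Filter G}.
Implicit Types (f g : T -> K) (a b : K).

Lemma cvg_valuedD f g a b :
  f @ G --> a -> g @ G --> b -> (fun t => f t + g t) @ G --> a + b.
Proof.
move=> /cvg_absvP fa /cvg_absvP gb; apply/cvg_absvP => e e0.
near=> t; rewrite opprD addrACA; apply: absvD_lt; near: t; [exact: fa|exact: gb].
Unshelve. all: by end_near. Qed.

Lemma cvg_valuedM f g a b :
  f @ G --> a -> g @ G --> b -> (fun t => f t * g t) @ G --> a * b.
Proof.
move=> /cvg_absvP fa /cvg_absvP gb; apply/cvg_absvP => e e0.
(* [c] dominates 1, [v a] and [v b], so each term of the three-term splitting of the difference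
   below has absolute value less than [e]. *)
pose c := 1 + v a + v b; have [va vb] : 0 <= v a /\ 0 <= v b.
  by rewrite !absv_ge0.
have c0 : 0 < c by rewrite /c; lra.
have ec0 : 0 < e / c by rewrite divr_gt0.
near=> t; have [f1 fe ge] :
    [/\ v (f t - a) < 1, v (f t - a) < e / c & v (g t - b) < e / c].
  by split; near: t; [exact: fa|exact: fa|exact: gb].
rewrite (_ : _ - _ =
    (f t - a) * (g t - b) + (f t - a) * b + a * (g t - b)); last by ring.
move: fe ge; rewrite !ltr_pdivlMr // /c => fe ge.
have [f0 g0] := (absv_ge0 v (f t - a), absv_ge0 v (g t - b)).
by apply: absvD_lt; [apply: absvD_lt|]; rewrite absvM; nra.
Unshelve. all: by end_near. Qed.

Lemma cvg_valuedV f a : a != 0 -> f @ G --> a -> (fun t => (f t)^-1) @ G --> a^-1.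
Proof.
move=> a0 /cvg_absvP fa; apply/cvg_absvP => e e0.
have va0 := absv_gt0 v _ a0.
near=> t; have [fta fte] : v (f t - a) < v a /\ v (f t - a) < e * v a ^+ 2.
  by split; near: t; apply: fa => //; rewrite mulr_gt0 // exprn_gt0.
(* Otherwise [a], the difference of [f t] and [f t - a], would have absolute value below [v a]. This
   keeps the denominator away from 0. *)
have vaf : v a <= v (f t).
  rewrite leNgt; apply/negP => vfa; have := absvB_lt _ _ _ _ vfa fta.
  by rewrite opprB addrC subrK ltxx.
have ft0 : f t != 0.
  by apply/eqP => ft0; move: vaf; rewrite ft0 absv0 leNgt va0.
rewrite (_ : _ - _ = (a - f t) / (f t * a)); last by field; rewrite a0 ft0.
rewrite absvM absvV absvM absvBC ltr_pdivrMr; last first.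
  by rewrite mulr_gt0 // (lt_le_trans va0).
by apply: lt_le_trans fte _; rewrite expr2 ler_pM2l // ler_pM2r.
Unshelve. all: by end_near. Qed.

Lemma cvg_valuedX f a n : f @ G --> a -> (fun t => f t ^+ n) @ G --> a ^+ n.
Proof.
move=> fa; elim: n => [|n IHn]; first exact: cvg_cst.
rewrite exprS (_ : (fun _ => _) = fun t => f t * f t ^+ n).
  exact: cvg_valuedM.
by apply/funext => t; rewrite exprS.
Qed.

Lemma cvg_valuedN f a : f @ G --> a -> (fun t => - f t) @ G --> - a.
Proof.
move=> /cvg_absvP fa; apply/cvg_absvP => e e0.
by near do rewrite -opprD absvN; exact: fa.
Unshelve. all: by end_near. Qed.

Lemma cvg_valued_sum (I : Type) (r : seq I) (f : I -> T -> K) (a : I -> K) :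
  (forall i, f i @ G --> a i) ->
  (fun t => \sum_(i <- r) f i t) @ G --> \sum_(i <- r) a i.
Proof.
move=> fa; elim: r => [|i r IHr].
  rewrite big_nil (_ : (fun _ => _) = fun=> 0); first exact: cvg_cst.
  by apply/funext => t; rewrite big_nil.
rewrite big_cons (_ : (fun _ => _) = fun t => f i t + \sum_(j <- r) f j t).
  exact: cvg_valuedD.
by apply/funext => t; rewrite big_cons.
Qed.

End Arithmetic.

Lemma limn_valued (f : nat -> K) (l : K) : f @ \oo --> l -> limn f = l.
Proof. by apply: cvg_lim; exact: metric_hausdorff. Qed.

End Limits.

(** * p-adic estimates and density of the natural numbers in Z_p *)

Section PadicIntegers.
Context {R : realType} {p : nat} {F : fieldType} {v : absvalue R F}.
Hypotheses (p_prime : prime p) (v_padic : extends_padic_absv p v).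
Local Notation K := (valued v).
Implicit Types (x y : K) (m n k : nat).

Let p_gt0 : 0 < p%:R :> R.
Proof. by rewrite ltr0n prime_gt0. Qed.

Let pV_ge0_lt1 : 0 <= (p%:R^-1 : R) < 1.
Proof. by rewrite invr_ge0 ltW //= invf_lt1 ?ltr1n ?prime_gt1. Qed.

Lemma natr_padic_neq0 n : (0 < n)%N -> n%:R != 0 :> F.
Proof.
move=> n0; apply/eqP => nE; have /eqP := v_padic _ n0.
by rewrite nE absv0 eq_sym invr_eq0 expf_eq0 gt_eqF ?andbF.
Qed.

Lemma absv_p : v p%:R = p%:R^-1.
Proof. by rewrite v_padic ?prime_gt0 // (logn_prime p p_prime) eqxx expr1. Qed.

Lemma absv_nat_coprime n : coprime p n -> v n%:R = 1.
Proof.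
move=> pn; have n0 : (0 < n)%N.
  by case: n pn => //; rewrite /coprime gcdn0; case: p p_prime => [|[]].
by rewrite v_padic // logn_coprime // invr1.
Qed.

(** Turns p-adic smallness back into divisibility, so that close naturals become congruent ones. *)
Lemma absv_nat_le k n : v n%:R <= p%:R^-1 ^+ k -> (p ^ k %| n)%N.
Proof.
have [->//|n0] := posnP n.
rewrite v_padic // pfactor_dvdn // -exprVn ler_iXn2l //.
- by rewrite invr_gt0.
- by case/andP: pV_ge0_lt1.
Qed.

Lemma cvg_pexp : (fun N => (p ^ N)%:R : K) @ \oo --> (0 : K).
Proof.
apply/cvg_absvP => e e0; have := near_expr_lt R _ _ pV_ge0_lt1 e0.
by apply: filterS => N; rewrite subr0 natrX absvX absv_p.
Qed.

(** Each p-th power gains a factor [r]: the cofactor of [w - 1] in [w ^+ p - 1] is p plus a sum of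
    differences [w ^+ i - 1], all of absolute value at most [r]. *)
Lemma absv_pexp_near1 (u : F) (r : R) N : v (u - 1) <= r -> p%:R^-1 <= r ->
  r < 1 -> v (u ^+ (p ^ N) - 1) <= r ^+ N.+1.
Proof.
move=> ur pr r1; have r0 : 0 <= r by apply: le_trans pr; case/andP: pV_ge0_lt1.
elim: N => [|N IHN]; first by rewrite expr1.
have rN : r ^+ N.+1 <= r by rewrite exprS ler_piMr // exprn_ile1 // ltW.
set w := u ^+ (p ^ N) in IHN *; rewrite expnSr exprM -/w subrX1 absvM exprSr.
apply: ler_pM; rewrite ?absv_ge0 //.
have w1 : v w = 1.
  by apply: absv_near1; apply: le_lt_trans IHN (le_lt_trans rN r1).
have -> : \sum_(i < p) w ^+ i = p%:R + \sum_(i < p) (w ^+ i - 1).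
  by rewrite sumrB sumr_const card_ord addrC subrK.
apply: absvD_le; first by rewrite absv_p.
apply: absv_sum_le => // i _; apply: le_trans (le_trans IHN rN).
by rewrite -[nat_of_ord i]mul1n -{2}[w]expr1 absv_exprB_le.
Qed.

Lemma absv_pexp_near (u : F) (e : R) : v (u - 1) < 1 -> 0 < e ->
  \forall N \near \oo, v (u ^+ (p ^ N) - 1) < e.
Proof.
move=> u1 e0; pose r := Num.max (v (u - 1)) p%:R^-1.
have r1 : r < 1 by rewrite gt_max u1; case/andP: pV_ge0_lt1.
have r0 : 0 <= r by rewrite le_max absv_ge0.
have r01 : 0 <= r < 1 by rewrite r0.
have := near_expr_lt R _ _ r01 e0; apply: filterS => N; apply: le_lt_trans.
apply: (@le_trans _ _ (r ^+ N.+1)).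
  by apply: absv_pexp_near1; rewrite // le_max lexx ?orbT.
by rewrite exprS ler_piMl ?exprn_ge0 // ltW.
Qed.

Lemma cvg_expr_pexp (u : K) : v (u - 1) < 1 ->
  (fun N => u ^+ (p ^ N)) @ \oo --> (1 : K).
Proof. by move=> u1; apply/cvg_absvP => e; exact: absv_pexp_near. Qed.

(** Exponents that are p-adically close differ by a multiple c p^N, and then [u ^+ m - u ^+ n] is
    [u ^+ n] times u^(c p^N) - 1, which is small. This is what extends the power map to Z_p. *)
Lemma expr_unif_continuous (u : F) (e : R) : v (u - 1) < 1 -> 0 < e ->
  exists2 d, 0 < d & forall m n, v (m%:R - n%:R) < d ->
    v (u ^+ m - u ^+ n) < e.
Proof.
move=> u1 e0; have [N _ /(_ N (leqnn N)) /= uN] := absv_pexp_near _ _ u1 e0.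
exists (p%:R^-1 ^+ N); first by rewrite exprn_gt0 // invr_gt0.
move=> m n; wlog nm : m n / (n <= m)%N => [wh|].
  have [nm|/ltnW mn] := leqP n m; first exact: wh.
  by rewrite absvBC [v (_ ^+ _ - _)]absvBC; exact: wh.
rewrite -natrB // => /ltW /absv_nat_le /dvdnP[c mnE].
rewrite -(subnK nm) exprD mnE -{2}[u ^+ n]mul1r -mulrBl absvM.
rewrite absvX (absv_near1 _ _ u1) expr1n mulr1 mulnC.
apply: le_lt_trans (uN); rewrite absv_exprB_le //.
exact: absv_near1.
Qed.

Lemma nat_dense_int (z : int) k : exists n, v (n%:R - z%:~R) <= p%:R^-1 ^+ k.
Proof.
(* Adding |z| p^k to [z] makes it nonnegative without changing it modulo p^k. *)
exists `|(z + `|z|%N%:Z * (p ^ k)%N%:Z)%R|%N.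
have pk1 : (1 <= p ^ k)%N by rewrite expn_gt0 prime_gt0.
rewrite pmulrn gez0_abs; last first.
  have := ler_norm (- z); rewrite normrN abszE => zN.
  have : `|z| <= `|z| * (p ^ k)%N%:Z by rewrite ler_peMr // lez_nat.
  lra.
rewrite rmorphD rmorphM /= -!pmulrn addrC addKr natrX absvM absvX absv_p.
by rewrite ler_piMl ?absv_nat_le1 // exprn_ge0 //; case/andP: pV_ge0_lt1.
Qed.

Lemma nat_dense_rat (r : rat) k : v (ratr r) <= 1 ->
  exists n, v (n%:R - ratr r) <= p%:R^-1 ^+ k.
Proof.
rewrite /ratr; have := coprime_num_den r; have := denq_gt0 r.
case: (denq r) => // d; rewrite /= ltz_nat => d0; move: (numq r) => a ad.
rewrite -pmulrn absvM absvV => vr.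
(* A factor p in the denominator would be absent from the coprime numerator and force an absolute
   value above 1. *)
have pd : coprime p d.
  rewrite prime_coprime //; apply/negP => pd.
  have pa : coprime p `|a|.
    by rewrite coprime_sym; exact: coprime_dvdr pd ad.
  have va : v a%:~R = 1.
    by rewrite absv_int absv_nat_coprime.
  move: vr; rewrite va mul1r => vd.
  have vd0 : 0 < v d%:R by rewrite absv_gt0 // natr_padic_neq0.
  move: vd; rewrite invf_le1 // leNgt => /negP; apply.
  case/dvdnP: pd => c ->; rewrite natrM absvM absv_p.
  apply: (@le_lt_trans _ _ p%:R^-1); last by case/andP: pV_ge0_lt1.
  by rewrite ler_piMl ?absv_nat_le1 // invr_ge0 ltW.
have vd := absv_nat_coprime _ pd.
(* By Bezout, [s] is an inverse of [d] modulo p^k, so the integer a s approximates a / d to the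
   required precision. *)
have [s w sE _] := egcdnP (p ^ k) d0.
have := coprimeXl k pd; rewrite coprime_sym /coprime => /eqP g1.
rewrite g1 in sE.
have [n nE] := nat_dense_int (a * s%:Z) k; exists n.
rewrite -(subrK (a * s%:Z)%:~R n%:R) -addrA; apply: absvD_le => //.
have d0' : d%:R != 0 :> F by rewrite natr_padic_neq0.
have -> : (a * s%:Z)%:~R - a%:~R / d%:R =
    a%:~R * w%:R / d%:R * p%:R ^+ k :> F.
  have sdE : s%:R * d%:R = w%:R * p%:R ^+ k + 1 :> F.
    by rewrite -natrM sE natrD natrM natrX.
  apply: (mulIf d0'); rewrite mulrBl divfK // rmorphM /= -pmulrn.
  rewrite -[_ * s%:R * _]mulrA sdE; field.
  by rewrite d0'.
have /andP[pV0 _] := pV_ge0_lt1.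
rewrite absvM absvX absv_p ler_piMl ?exprn_ge0 //.
rewrite !absvM absvV vd invr1 mulr1 mulr_ile1 ?absv_ge0 ?absv_int_le1 //.
exact: absv_nat_le1.
Qed.

(** The form in which membership in Z_p is used from here on: identities between powers with natural
    exponents pass to the limit along such a sequence. *)
Definition nat_approx x :=
  exists s : nat -> nat, (fun i => (s i)%:R : K) @ \oo --> x.

Lemma padic_int_nat_approx x : padic_int x -> nat_approx x.
Proof.
move=> [x_rat x_le1].
have approx i : exists n, v (n%:R - x) <= p%:R^-1 ^+ i.
  have pi0 : 0 < p%:R^-1 ^+ i :> R by rewrite exprn_gt0 // invr_gt0.
  have [_ [[r _ <-] /= rx]] := x_rat _ (nbhs_absv x _ pi0).
  (* A rational close to a p-adic integer is itself p-integral, by the ultrametric inequality. *)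
  have r1 : v (ratr r) <= 1.
    rewrite -(subrK x (ratr r)) absvD_le // (le_trans (ltW rx)) //.
    by have /andP[pV0 /ltW pV1] := pV_ge0_lt1; rewrite exprn_ile1.
  have [n nr] := nat_dense_rat _ i r1; exists n.
  by rewrite -(subrKA (ratr r)) absvD_le // ltW.
exists (fun i => projT1 (cid (approx i))); apply/cvg_absvP => e e0.
have := near_expr_lt R _ _ pV_ge0_lt1 e0; apply: filterS => i.
by apply: le_lt_trans; case: cid.
Qed.

Lemma nat_approx_nat n : nat_approx n%:R.
Proof. by exists (fun=> n); exact: cvg_cst. Qed.

Lemma nat_approxMn n x : nat_approx x -> nat_approx (n%:R * x).
Proof.
move=> [s sx]; exists (fun i => n * s i)%N.
under eq_fun do rewrite natrM.
by apply: cvg_valuedM => //; exact: cvg_cst.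
Qed.

(* - x is the limit of (p ^ i - 1) s_i whenever x is the limit of s_i. *)
Lemma nat_approxN x : nat_approx x -> nat_approx (- x).
Proof.
move=> [s sx]; exists (fun i => (p ^ i).-1 * s i)%N.
have sE : (fun i => ((p ^ i).-1 * s i)%:R) =
    fun i => (p ^ i)%:R * (s i)%:R + - (s i)%:R :> K.
  apply/funext => i.
  by rewrite -subn1 natrM natrB ?expn_gt0 ?prime_gt0 // mulrBl mul1r.
rewrite sE -[- x]add0r -[0](mul0r x).
apply: cvg_valuedD; last exact: cvg_valuedN.
by apply: cvg_valuedM => //; exact: cvg_pexp.
Qed.

End PadicIntegers.

(** * The filter of naturals tending to a p-adic point *)

Section NatFilter.
Context {R : realType} {F : fieldType} {v : absvalue R F}.
Local Notation K := (valued v).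

#[local] Instance nat_nbhs_filter (x : K) : Filter (nat_nbhs x).
Proof.
apply: filter_from_filter; first by exists setT; exact: filterT.
move=> A B xA xB; exists (A `&` B); first exact: filterI.
by move=> n [].
Qed.

Lemma cvg_nat_nbhs (x : K) (s : nat -> nat) :
  (fun i => (s i)%:R : K) @ \oo --> x -> s @ \oo --> nat_nbhs x.
Proof.
move=> sx A [B xB BA]; have sB : \forall i \near \oo, B (s i)%:R := sx _ xB.
by near do apply: BA; exact: sB.
Unshelve. all: by end_near.
Qed.

(** Every set of the filter contains a tail of the approximating sequence, hence is nonempty. *)
Lemma nat_nbhs_proper (x : K) : nat_approx x -> ProperFilter (nat_nbhs x).
Proof.
move=> [s /cvg_nat_nbhs sx]; apply: Build_ProperFilter => /sx.
by case/filter_ex.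
Qed.

End NatFilter.

(** * q-powers and q-numbers with p-adic exponents *)

Section QPower.
Context {R : realType} {p : nat} {F : fieldType} {v : absvalue R F}.
Hypotheses (p_prime : prime p) (F_Cp : is_Cp p v).
Local Notation K := (valued v).
Implicit Types (q x y : K) (m n k : nat).

Let v_padic : extends_padic_absv p v := Cp_absv F_Cp.

(** Uniform continuity of the power map makes the image filter Cauchy, and completeness provides the
    limit; thus [qpow] is a true limit and not the default value of [lim]. *)
Lemma cvg_qpow q x : v (q - 1) < 1 -> nat_approx x ->
  (fun n => q ^+ n) @ nat_nbhs x --> qpow q x.
Proof.
move=> q1 x_approx; have xPF := nat_nbhs_proper x x_approx.
apply: (Cp_complete F_Cp); apply: cauchy_exP => e e0.
have [d d0 qd] := expr_unif_continuous p_prime v_padic _ _ q1 e0.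
have xd : nat_nbhs x [set n | v (n%:R - x) < d].
  by exists [set y : K | v (y - x) < d]; first exact: nbhs_absv.
have [n /= nx] := filter_ex xd.
exists (q ^+ n); apply: filterS xd => m /= mx.
rewrite ballEmdist; apply: qd; rewrite -(subrKA x).
by apply: absvD_lt => //; rewrite absvBC.
Qed.

Lemma cvg_qpow_seq q x (s : nat -> nat) : v (q - 1) < 1 ->
  (fun i => (s i)%:R : K) @ \oo --> x -> (fun i => q ^+ s i) @ \oo --> qpow q x.
Proof.
move=> q1 sx; apply: (cvg_comp _ _ (cvg_nat_nbhs _ _ sx)).
by apply: cvg_qpow => //; exists s.
Qed.

(** Any sequence of naturals tending to [x] computes the q-power. The exponent laws below follow by
    choosing a suitable sequence. *)
Lemma qpow_seqE q x l (s : nat -> nat) : v (q - 1) < 1 ->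
  (fun i => (s i)%:R : K) @ \oo --> x -> (fun i => q ^+ s i) @ \oo --> l ->
  qpow q x = l.
Proof.
move=> q1 sx /limn_valued <-.
by rewrite (limn_valued _ _ (cvg_qpow_seq _ _ _ q1 sx)).
Qed.

Lemma qpow_nat q n : v (q - 1) < 1 -> qpow q n%:R = q ^+ n.
Proof. by move=> q1; apply: (@qpow_seqE _ _ _ (fun=> n)) => //; exact: cvg_cst. Qed.

Lemma qpow1 x : nat_approx x -> qpow 1 x = 1.
Proof.
move=> [s sx]; apply: (@qpow_seqE _ _ _ s) => //.
  by rewrite subrr absv0.
under eq_fun do rewrite expr1n.
exact: cvg_cst.
Qed.

Lemma qpowD q x y : v (q - 1) < 1 -> nat_approx x -> nat_approx y ->
  qpow q (x + y) = qpow q x * qpow q y.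
Proof.
move=> q1 [s sx] [t ty].
apply: (@qpow_seqE _ _ _ (fun i => s i + t i)%N) => //.
  under eq_fun do rewrite natrD.
  exact: cvg_valuedD.
under eq_fun do rewrite exprD.
by apply: cvg_valuedM; exact: cvg_qpow_seq.
Qed.

Lemma qpowMn q n x : v (q - 1) < 1 -> nat_approx x ->
  qpow q (n%:R * x) = qpow q x ^+ n.
Proof.
move=> q1 [s sx]; apply: (@qpow_seqE _ _ _ (fun i => s i * n)%N) => //.
  under eq_fun do rewrite mulnC natrM.
  by apply: cvg_valuedM => //; exact: cvg_cst.
under eq_fun do rewrite exprM.
by apply: cvg_valuedX; exact: cvg_qpow_seq.
Qed.

Lemma qpowX q n x : v (q - 1) < 1 -> nat_approx x ->
  qpow (q ^+ n) x = qpow q x ^+ n.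
Proof.
move=> q1 [s sx]; apply: (@qpow_seqE _ _ _ s) => //.
  exact: absv_exp_near1.
under eq_fun do rewrite -exprM mulnC exprM.
by apply: cvg_valuedX; exact: cvg_qpow_seq.
Qed.

Lemma qpowN q x : v (q - 1) < 1 -> nat_approx x ->
  qpow q (- x) = (qpow q x)^-1.
Proof.
move=> q1 xa; have xNa := nat_approxN p_prime v_padic _ xa.
have qxN : qpow q (- x) * qpow q x = 1.
  by rewrite -qpowD // addNr -[0]/(0%:R) qpow_nat.
have qx0 : qpow q x != 0.
  by apply: contra_eq_neq qxN => ->; rewrite mulr0 eq_sym oner_eq0.
by apply: (mulIf qx0); rewrite qxN mulVf.
Qed.

Lemma qpow_neq0 q x : v (q - 1) < 1 -> nat_approx x -> qpow q x != 0.
Proof.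
move=> q1 xa; have xNa := nat_approxN p_prime v_padic _ xa.
have := qpowD q x (- x) q1 xa xNa; rewrite subrr -[0]/(0%:R) qpow_nat //.
by apply: contra_eq_neq => ->; rewrite mul0r oner_eq0.
Qed.

Lemma qnumD q x y : v (q - 1) < 1 -> nat_approx x -> nat_approx y ->
  qnum q (x + y) = qnum q x + qpow q x * qnum q y.
Proof.
move=> q1 xa ya; rewrite /qnum; case: eqVneq => [->|q_neq1].
  by rewrite qpow1 // mul1r.
have d0 : 1 - q != 0 by rewrite subr_eq0 eq_sym.
by rewrite qpowD //; field.
Qed.

Lemma qnum0 q : v (q - 1) < 1 -> qnum q 0 = 0.
Proof.
move=> q1; rewrite /qnum; case: eqVneq => // _.
by rewrite -[0 as X in qpow _ X]/(0%:R) qpow_nat // subrr mul0r.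
Qed.

Lemma qnum1 q : v (q - 1) < 1 -> qnum q 1 = 1.
Proof.
move=> q1; rewrite /qnum; case: eqVneq => // q_neq1.
by rewrite -[1 as X in qpow _ X]/(1%:R) qpow_nat // expr1 divff // subr_eq0 eq_sym.
Qed.

Lemma cvg_qnum_pexp q : v (q - 1) < 1 ->
  (fun N => qnum q (p ^ N)%:R) @ \oo --> (0 : K).
Proof.
move=> q1; rewrite /qnum; have [_|q_neq1] := eqVneq q 1; first exact: cvg_pexp.
under eq_fun do rewrite qpow_nat //.
rewrite -[0](mul0r (1 - q)^-1) -(subrr 1); apply: cvg_valuedM; last exact: cvg_cst.
apply: cvg_valuedD; first exact: cvg_cst.
by apply: cvg_valuedN; exact: cvg_expr_pexp.
Qed.

End QPower.

Lemma telescope_alternating (A : comNzRingType) (f : nat -> A) (M : nat) :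
  \sum_(0 <= i < M) (f i.+1 + f i) * (-1) ^+ i = f 0%N - f M * (-1) ^+ M.
Proof.
elim: M => [|M IHM]; first by rewrite big_geq // expr0 mulr1 subrr.
by rewrite big_nat_recr //= IHM exprS; ring.
Qed.

(** * Umbral evaluation of powers of a linear polynomial *)

Section Umbral.
Context {R : realType} {F : fieldType} {v : absvalue R F}.
Local Notation K := (valued v).

(** Lets a bound replace the exact size of the polynomial, which for a binomial power depends on
    whether its coefficients vanish. *)
Lemma umbral_widen (a : nat -> K) (P : {poly K}) m : (size P <= m)%N ->
  umbral a P = \sum_(k < m) P`_k * a k.
Proof.
move=> Pm; rewrite /umbral (big_ord_widen m (fun k => P`_k * a k) Pm) big_mkcond.
apply: eq_bigr => k _; case: ltnP => // kP.
by rewrite nth_default // mul0r.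
Qed.

Lemma umbral_linear_exp (a : nat -> K) (c b : K) n :
  umbral a ((c *: 'X + b%:P) ^+ n) =
  \sum_(0 <= k < n.+1) 'C(n, k)%:R * c ^+ k * a k * b ^+ (n - k).
Proof.
have -> : (c *: 'X + b%:P) ^+ n =
    \poly_(k < n.+1) ('C(n, k)%:R * c ^+ k * b ^+ (n - k)).
  rewrite poly_def addrC exprDn; apply: eq_bigr => k _.
  rewrite exprZn -polyC_exp mul_polyC scalerA -scaler_nat scalerA.
  by congr (_ *: _); ring.
rewrite (umbral_widen _ _ n.+1) ?size_poly // big_mkord.
by apply: eq_bigr => k _; rewrite coef_poly ltn_ord mulrAC.
Qed.

End Umbral.

(** * Existence and expansion of the fermionic moments *)

Section FermionicIntegral.
Context {R : realType} {p : nat} {F : fieldType} {v : absvalue R F}.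
Hypotheses (p_prime : prime p) (p_odd : odd p) (F_Cp : is_Cp p v).
Local Notation K := (valued v).
Implicit Types (q u x y : K) (m n k : nat).

Let v_padic : extends_padic_absv p v := Cp_absv F_Cp.

(** If [u] were -1, then [u - 1] would be -2, which has absolute value 1 because p is odd. *)
Lemma add1r_near1_neq0 u : v (u - 1) < 1 -> 1 + u != 0.
Proof.
move=> u1; apply/eqP => uE; move: u1.
rewrite (_ : u - 1 = - 2%:R); last by rewrite -[u](addKr 1) uE; ring.
by rewrite absvN (absv_nat_coprime p_prime v_padic) ?coprimen2 // ltxx.
Qed.

(** The sum T_k(M) of the outline above, with [q] in the role of t. *)
Definition alternating_sum q k M : K :=
  \sum_(0 <= xi < M) qnum q xi%:R ^+ k * (-1) ^+ xi.

(* Sum (-1)^xi ([xi+1]^k + [xi]^k) over xi < M in two ways: it telescopes, and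
   [xi+1] = 1 + q [xi] expands it. *)
Lemma alternating_sum_rec q k M : v (q - 1) < 1 -> odd M ->
  alternating_sum q k M = (1 + q ^+ k)^-1 *
    (0 ^+ k + qnum q M%:R ^+ k -
     \sum_(j < k) 'C(k, j)%:R * q ^+ j * alternating_sum q j M).
Proof.
move=> q1 M_odd.
have qk0 : 1 + q ^+ k != 0 by apply/add1r_near1_neq0/absv_exp_near1.
apply: (mulfI qk0); rewrite mulVKf //; apply/eqP; rewrite eq_sym subr_eq eq_sym.
have := telescope_alternating _ (fun i => qnum q i%:R ^+ k) M.
rewrite (qnum0 p_prime F_Cp) // -signr_odd M_odd mulrN1 opprK => <-.
have qnumS i : qnum q i.+1%:R = 1 + q * qnum q i%:R.
  rewrite -natr1 addrC (qnumD p_prime F_Cp) //;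
    [|exact: (nat_approx_nat 1)|exact: nat_approx_nat].
  by rewrite (qnum1 p_prime F_Cp) // -[1 as X in qpow _ X]/(1%:R)
    (qpow_nat p_prime F_Cp).
have -> : \sum_(0 <= i < M) (qnum q i.+1%:R ^+ k + qnum q i%:R ^+ k) * (-1) ^+ i =
    \sum_(j < k.+1) 'C(k, j)%:R * q ^+ j * alternating_sum q j M +
    alternating_sum q k M.
  under eq_bigr do rewrite qnumS exprDn mulrDl.
  rewrite big_split /=; congr (_ + _).
  under eq_bigr do rewrite mulr_suml.
  rewrite exchange_big /=; apply: eq_bigr => j _.
  rewrite /alternating_sum mulr_sumr; apply: eq_bigr => i _.
  by rewrite expr1n mul1r exprMn -mulr_natl; ring.
by rewrite big_ord_recr /= binn; apply/eqP; ring.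
Qed.

Lemma is_cvg_alternating_sum q k : v (q - 1) < 1 ->
  cvgn (fun N => alternating_sum q k (p ^ N)).
Proof.
move=> q1; elim/ltn_ind: k => k IHk.
under eq_fun do rewrite alternating_sum_rec ?oddX ?p_odd ?orbT //.
apply: cvgP; apply: cvg_valuedM; first exact: cvg_cst.
apply: cvg_valuedD.
  apply: cvg_valuedD; first exact: cvg_cst.
  by apply: cvg_valuedX; exact: (cvg_qnum_pexp p_prime F_Cp).
apply: cvg_valuedN; apply: cvg_valued_sum => j.
by apply: cvg_valuedM; [exact: cvg_cst|exact: IHk].
Qed.

(** As p^N is odd, the numerator of the q-number is 1 + u^(p^N), which tends to 2; the limit is
    nonzero, so inversion is continuous there. *)
Lemma cvg_qnat_pexp u : v (u - 1) < 1 ->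
  (fun N => (qnat (- u) (p ^ N))^-1) @ \oo --> ((2%:R : K) / (1 + u))^-1.
Proof.
move=> u1; have u0 := add1r_near1_neq0 u u1.
have two0 : 2%:R != 0 :> K by rewrite (natr_padic_neq0 p_prime v_padic).
apply: cvg_valuedV; first by rewrite mulf_neq0 ?invr_neq0.
rewrite /qnat opprK; apply: cvg_valuedM; last exact: cvg_cst.
have -> : (fun N => 1 - (- u) ^+ (p ^ N)) = (fun N => 1 + u ^+ (p ^ N)).
  by apply/funext => N; rewrite exprNn -signr_odd oddX p_odd orbT expr1 mulN1r opprK.
rewrite -[2%:R]/(1 + 1); apply: cvg_valuedD; first exact: cvg_cst.
exact: (cvg_expr_pexp p_prime v_padic).
Qed.

Lemma fermionic_sumE q beta (g : K -> K) N : v (q - 1) < 1 ->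
  fermionic_sum p (q ^+ beta) (fun xi => qpow q (- (beta%:R * xi)) * g xi) N =
  (qnat (- q ^+ beta) (p ^ N))^-1 * \sum_(0 <= xi < p ^ N) g xi%:R * (-1) ^+ xi.
Proof.
move=> q1; congr (_ * _); apply: eq_bigr => xi _; congr (_ * _).
rewrite -natrM (qpowN p_prime F_Cp) //; last exact: nat_approx_nat.
rewrite (qpow_nat p_prime F_Cp) // exprM mulVKf // -exprM expf_neq0 //.
(* [q] is nonzero, since 0 is at distance 1 from 1. *)
by apply/eqP => q0; move: q1; rewrite q0 sub0r absvN absv1 ltxx.
Qed.

Definition qnum_moment q alpha beta m x : K :=
  fermionic_integral p (q ^+ beta)
    (fun xi => qpow q (- (beta%:R * xi)) * qnum (q ^+ alpha) (x + xi) ^+ m).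

(** Both factors converge, so the integral at 0 is an actual limit and can be used in limit
    arithmetic. *)
Lemma cvg_qnum_moment0 q alpha beta m : v (q - 1) < 1 ->
  (fun N => (qnat (- q ^+ beta) (p ^ N))^-1 * alternating_sum (q ^+ alpha) m (p ^ N))
    @ \oo --> qnum_moment q alpha beta m 0.
Proof.
move=> q1.
have := is_cvg_alternating_sum _ m (absv_exp_near1 v q alpha q1).
move=> /(cvg_valuedM _ _ _ _ (cvg_qnat_pexp _ (absv_exp_near1 v q beta q1))).
rewrite /qnum_moment /fermionic_integral.
set f := fermionic_sum _ _ _; suff -> : f = fun N =>
    (qnat (- q ^+ beta) (p ^ N))^-1 * alternating_sum (q ^+ alpha) m (p ^ N).
  by move/cvgP.
apply/funext => N.
rewrite /f (fermionic_sumE _ _ (fun xi => qnum (q ^+ alpha) (0 + xi) ^+ m)) //.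
by congr (_ * _); apply: eq_bigr => xi _; rewrite add0r.
Qed.

(** The binomial expansion already holds for each finite sum over xi < p^N. Its right side is a
    finite combination of convergent sequences, so convergence at [x] comes from that at 0. *)
Lemma qnum_momentD q alpha beta m x : v (q - 1) < 1 -> nat_approx x ->
  qnum_moment q alpha beta m x =
  \sum_(k < m.+1) 'C(m, k)%:R * qpow (q ^+ alpha) x ^+ k *
    qnum_moment q alpha beta k 0 * qnum (q ^+ alpha) x ^+ (m - k).
Proof.
move=> q1 xa; have t1 := absv_exp_near1 v q alpha q1.
apply: limn_valued.
set t := q ^+ alpha in t1 *.
have -> : fermionic_sum p (q ^+ beta)
    (fun xi => qpow q (- (beta%:R * xi)) * qnum t (x + xi) ^+ m) =
  (fun N => \sum_(k < m.+1) 'C(m, k)%:R * qpow t x ^+ k *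
    ((qnat (- q ^+ beta) (p ^ N))^-1 * alternating_sum t k (p ^ N)) *
    qnum t x ^+ (m - k)).
  apply/funext => N.
  rewrite (fermionic_sumE _ _ (fun xi => qnum t (x + xi) ^+ m)) //.
  under eq_bigr => xi _.
    rewrite (qnumD p_prime F_Cp) //; last exact: nat_approx_nat.
    rewrite exprDn mulr_suml; over.
  rewrite exchange_big mulr_sumr; apply: eq_bigr => k _.
  rewrite /alternating_sum !(mulr_sumr, mulr_suml); apply: eq_bigr => xi _.
  by rewrite exprMn -mulr_natl; ring.
apply: cvg_valued_sum => k; apply: cvg_valuedM; last exact: cvg_cst.
by apply: cvg_valuedM; [exact: cvg_cst|exact: cvg_qnum_moment0].
Qed.

End FermionicIntegral.

Theorem theorem1 (R : realType) (p : nat) (p_prime : prime p) (p_odd : odd p)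
    (Cp : fieldType) (v : absvalue R Cp) (HCp : is_Cp p v)
    (q : valued v) (q_near1 : v (q - 1) < 1)
    (alpha beta : nat) (x : valued v) (x_Zp : padic_int x) :
  (forall n : nat,
     genocchi_poly p q alpha beta n x =
     qpow q (- (alpha%:R * x)) *
       \sum_(0 <= k < n.+1)
          'C(n, k)%:R * qpow q ((alpha * k)%:R * x) *
          genocchi_num p q alpha beta k * qnum (q ^+ alpha) x ^+ (n - k))
  /\
  (forall n : nat,
     genocchi_poly p q alpha beta n x =
     qpow q (- (alpha%:R * x)) *
       umbral (genocchi_num p q alpha beta)
         ((qpow q (alpha%:R * x) *: 'X + (qnum (q ^+ alpha) x)%:P) ^+ n)).
Proof.
have xa := padic_int_nat_approx p_prime (Cp_absv HCp) x x_Zp.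
have axa := nat_approxMn alpha x xa.
have qpow_mul k : qpow q ((alpha * k)%:R * x) = qpow q (alpha%:R * x) ^+ k.
  by rewrite !(qpowMn p_prime HCp) // exprM.
have expansion n : genocchi_poly p q alpha beta n x =
    qpow q (- (alpha%:R * x)) *
       \sum_(0 <= k < n.+1)
          'C(n, k)%:R * qpow q ((alpha * k)%:R * x) *
          genocchi_num p q alpha beta k * qnum (q ^+ alpha) x ^+ (n - k).
  case: n => [|m]; first by rewrite big_nat1 /genocchi_num /= !(mulr0, mul0r).
  (* The term k = 0 vanishes because the Genocchi number of index 0 is 0; what remains is indexed by
     k + 1, matching the moment of order k. *)
  rewrite big_nat_recl // {1}/genocchi_num /= mulr0 mul0r add0r big_mkord.
  rewrite -/(qnum_moment q alpha beta m x) (qnum_momentD p_prime p_odd HCp) //.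
  rewrite !mulr_sumr; apply: eq_bigr => k _.
  (* The prefactor q^(- alpha x) cancels one of the k + 1 factors q^(alpha x). *)
  rewrite subSS (qpowN p_prime HCp) // qpow_mul exprS /genocchi_num /=.
  rewrite -/(qnum_moment q alpha beta k 0).
  rewrite (qpowX p_prime HCp) // -(qpowMn p_prime HCp) //.
  have c0 := qpow_neq0 p_prime HCp q _ q_near1 axa.
  (* The factor m + 1 from the definition of the polynomial is traded for the factor k + 1 of the
     Genocchi number of index k + 1. *)
  have binE : m.+1%:R * 'C(m, k)%:R = k.+1%:R * 'C(m.+1, k.+1)%:R :> Cp.
    by rewrite -!natrM mul_bin_diag.
  set c := qpow q _ in c0 *; set g := qnum_moment _ _ _ _ _.
  rewrite !mulrA binE; field.
  by rewrite c0.
split=> // n; rewrite expansion umbral_linear_exp.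
by congr (_ * _); apply: eq_bigr => k _; rewrite qpow_mul.
Qed.
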